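(* Let $R$ be a commutative ring with unity, let $n,\alpha\ge 2$ be integers, and let $g$ be a polynomial with coefficients in $R$ such that $g(0)\neq 0$. Let $A\in M_n(R)$ be similar over $R$ to $\mathrm{diag}(\lambda_1I_{n_1},\dots,\lambda_rI_{n_r})$ with $n_1+\cdots+n_r=n$ and $\lambda_1,\dots,\lambda_r\in R$ such that, for every $i\neq j$, $\lambda_i-\lambda_j$ is not a zero-divisor in $R$. Let $X\in M_n(R)$ be a nilpotent solution of $$XA-AX=X^{\alpha}g(X).$$ (i) Then there is $P\in GL_n(R)$ such that $$A=P\,\mathrm{diag}(\lambda_1I_{n_1},\dots,\lambda_rI_{n_r})\,P^{-1}\quad\text{and}\quad X=P\,\mathrm{diag}(X_1,\dots,X_r)\,P^{-1},$$ where, for every $i$, $X_i\in M_{n_i}(R)$ and $X_i^{\alpha}g(X_i)=0$. (ii) If moreover $g(0)$ is a unit of $R$, then $X^{\alpha}=0$.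
   Context: An element $z$ of a commutative ring $R$ is ''not a zero-divisor'' if $zr=0$ with $r\in R$ implies $r=0$. Two matrices $A,D\in M_n(R)$ are similar over $R$ if $A=PDP^{-1}$ for some $P\in GL_n(R)$. $\mathrm{diag}(X_1,\dots,X_r)$ denotes the block-diagonal matrix with diagonal blocks $X_1,\dots,X_r$. *)

(* Defs.v *)
From HB Require Import structures.
From mathcomp Require Import all_boot all_order all_algebra.
Set Implicit Arguments.
Unset Strict Implicit.
Unset Printing Implicit Defensive.
Import GRing.Theory.
Local Open Scope ring_scope.

Definition not_zero_divisor (R : comNzRingType) (z : R) : Prop :=
  forall r : R, z * r = 0 -> r = 0.

Definition nilpotent_mx (R : comNzRingType) (n : nat) (X : 'M[R]_n) : Prop :=
  exists k : nat, X ^+ k = 0.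

Definition similar_mx (R : comUnitRingType) (n : nat) (A D : 'M[R]_n) : Prop :=
  exists P : 'M[R]_n, P \in unitmx /\ A = P *m D *m invmx P.

(* [horner_mx] is only available for matrices of size [n.+1]; this is the same
   evaluation for a size that is not syntactically a successor (including 0). *)
Definition mx_eval (R : comNzRingType) (n : nat) (p : {poly R}) (X : 'M[R]_n) :
    'M[R]_n :=
  \sum_(i < size p) p`_i *: X ^+ i.

Lemma mx_evalE (R : comNzRingType) (n : nat) (p : {poly R}) (X : 'M[R]_n.+1) :
  mx_eval p X = horner_mx X p.
Proof.
rewrite /mx_eval -[in RHS](coefK p) poly_def raddf_sum.
by apply: eq_bigr => i _; rewrite /= horner_mxZ rmorphXn /= horner_mx_X.
Qed.

(* Main.v *)
Require Import Defs.
From HB Require Import structures.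
From mathcomp Require Import all_boot all_order all_algebra.
From mathcomp Require Import ring.
Set Implicit Arguments.
Unset Strict Implicit.
Unset Printing Implicit Defensive.
Import GRing.Theory.
Local Open Scope ring_scope.

(** Write [f = 'X^alpha * g], so that [X] solves [XA - AX = f(X)].  Bracketing
    with [A] is a derivation, and it sends the generator of the commutative
    algebra [R[X]] to [f(X)], which lies in that algebra again; hence it acts on
    [R[X]] as [p |-> p' f] ([bracket_horner]).  Since [alpha >= 2], this
    operator strictly raises the order of vanishing at 0, so some iterate of
    the bracket kills the nilpotent matrix [X] ([iter_bracket_nilpotent]).

    After conjugation [A] becomes [diag(lambda_i I)], for which the bracket
    multiplies the block [(i, j)] by the scalar [lambda_j - lambda_i].  An
    iterate of it multiplies an off-diagonal block by a power of this
    non-zero-divisor, so it can only kill block-diagonal matrices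
    ([mxdiag_of_iter_bracket]).  Thus [X] is block diagonal, it commutes with
    [A], and [f(X) = 0]; reading the last equation block by block gives the
    first claim.

    For the second claim, [g(X)] is the sum of the unit [g(0)] and a nilpotent
    matrix commuting with [X], so it cancels from [X^alpha g(X) = 0]
    ([expr_eq0_of_horner]). *)

(** * Brackets in the algebra generated by a nilpotent element *)

Definition bracket (E : pzRingType) (a y : E) : E := y * a - a * y.

Lemma bracketM (E : pzRingType) (a y z : E) :
  bracket a (y * z) = y * bracket a z + bracket a y * z.
Proof. by rewrite /bracket mulrBr mulrBl !mulrA addrA subrK. Qed.

Section BracketHorner.

Variables (R : comNzRingType) (E : algType R) (a x : E).

(** The chain rule for the derivation [bracket a]: it applies because
    [bracket a x], being a polynomial in [x], commutes with [x]. *)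
Lemma bracket_horner (f : {poly R}) :
  bracket a x = horner_alg x f ->
  forall p, bracket a (horner_alg x p) = horner_alg x (p^`() * f).
Proof.
move=> xf; elim/poly_ind => [|p c IHp].
  by rewrite deriv0 mul0r rmorph0 /bracket mul0r mulr0 subrr.
have bracketD y z : bracket a (y + z) = bracket a y + bracket a z.
  by rewrite /bracket mulrDl mulrDr opprD addrACA.
rewrite rmorphD rmorphM /= horner_algX horner_algC bracketD bracketM xf IHp.
rewrite [bracket a c%:A]/bracket -scalerAl -scalerAr mul1r mulr1 subrr addr0.
rewrite -[X in _ + _ * X](horner_algX x) -!rmorphM -rmorphD /=.
by congr (horner_alg x _); rewrite derivD derivC derivM derivX; ring.
Qed.

(** Differentiating costs one factor [x] and multiplying by ['X^2 * h] restores
    two, so each bracket raises the order of vanishing by one. *)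
Lemma iter_bracket_horner (h : {poly R}) k :
  bracket a x = horner_alg x ('X^2 * h) ->
  exists q, iter k (bracket a) x = horner_alg x ('X^(k.+1) * q).
Proof.
move=> xh; elim: k => [|k [q IHk]].
  by exists 1; rewrite mulr1 horner_algX.
exists ((q *+ k.+1 + 'X * q^`()) * h).
rewrite iterS IHk (bracket_horner xh) derivM derivXn /=; congr (horner_alg x _).
rewrite mulrnAl -mulrnAr !exprS; set t := q *+ _; ring.
Qed.

Lemma iter_bracket_nilpotent (h : {poly R}) k :
    bracket a x = horner_alg x ('X^2 * h) -> x ^+ k = 0 ->
  iter k (bracket a) x = 0.
Proof.
move=> /(iter_bracket_horner k)[q ->] xk0.
by rewrite rmorphM rmorphXn /= horner_algX exprSr xk0 !mul0r.
Qed.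

End BracketHorner.

(** Modulo [x ^+ k.+1] one has [x ^+ k * g(x) = g(0) x ^+ k]; so when [g(0)] is
    a unit, the least vanishing power of [x] has exponent at most [n]. *)
Lemma expr_eq0_of_horner (R : comUnitRingType) (E : algType R) (x : E)
    (g : {poly R}) n j :
    g.[0] \is a GRing.unit -> x ^+ n * horner_alg x g = 0 -> x ^+ j = 0 ->
  x ^+ n = 0.
Proof.
move=> g0 xng xj0; have: x ^+ (n + j) = 0 by rewrite exprD xj0 mulr0.
elim: j {xj0} => [|j IHj]; first by rewrite addn0.
rewrite addnS => xS0; apply: IHj.
have [h gE] : exists h, g = h * 'X + (g.[0])%:P.
  have /factor_theorem[h hE] : root (g - (g.[0])%:P) 0.
    by rewrite rootE hornerD hornerN hornerC subrr.
  by exists h; rewrite -[g in LHS](subrK (g.[0])%:P) hE subr0.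
have: x ^+ (n + j) * horner_alg x g = 0.
  by rewrite addnC exprD -mulrA xng mulr0.
rewrite gE (mulrC h) rmorphD rmorphM /= horner_algX horner_algC mulrDr mulrA.
rewrite -exprSr xS0 mul0r add0r -scalerAr mulr1 => /(congr1 ( *:%R g.[0]^-1)).
by rewrite scalerA mulVr // scale1r scaler0.
Qed.

(** * Polynomials evaluated at square matrices of arbitrary size *)

Section MatrixEvaluation.

Variable R : comUnitRingType.
Implicit Types (g : {poly R}) (n : nat).

Lemma mx_eval_horner_alg n g (X : 'M[R]_n.+1) : mx_eval g X = horner_alg X g.
Proof.
rewrite /mx_eval -[in RHS](coefK g) poly_def raddf_sum.
apply: eq_bigr => i _.
by rewrite /= linearZ rmorphXn /= horner_algX mulr_algl.
Qed.

Lemma iter_bracket_nilpotent_mx n g alpha (A X : 'M[R]_n) :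
    (2 <= alpha)%N -> nilpotent_mx X ->
    bracket A X = X ^+ alpha *m mx_eval g X ->
  exists k, iter k (bracket A) X = 0.
Proof.
case: n A X => [|n] A X alpha2 [k Xk0] XA; first by exists 0; exact: thinmx0.
exists k; apply: (@iter_bracket_nilpotent _ _ _ _ ('X^(alpha - 2) * g)) => //.
rewrite XA mx_eval_horner_alg mulrA -exprD subnKC //.
by rewrite rmorphM rmorphXn /= horner_algX.
Qed.

Lemma expr_mx_eq0 n g alpha (X : 'M[R]_n) :
    g.[0] \is a GRing.unit -> nilpotent_mx X ->
    X ^+ alpha *m mx_eval g X = 0 ->
  X ^+ alpha = 0.
Proof.
case: n X => [|n] X g0 [k Xk0]; first by move=> _; exact: thinmx0.
rewrite mx_eval_horner_alg => Xg; exact: (expr_eq0_of_horner g0 Xg Xk0).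
Qed.

Variables (n : nat) (P : 'M[R]_n).
Hypothesis Punit : P \in unitmx.

Lemma conj_mxM (Y Z : 'M[R]_n) :
  P *m Y *m invmx P *m (P *m Z *m invmx P) = P *m (Y *m Z) *m invmx P.
Proof. by rewrite !mulmxA mulmxKV. Qed.

Lemma conj_mx_inj (Y : 'M[R]_n) : P *m Y *m invmx P = 0 -> Y = 0.
Proof.
move=> /(congr1 (mulmx (invmx P)))/(congr1 (mulmx^~ P)).
by rewrite /= mulmx0 mul0mx -!mulmxA mulVmx // mulmx1 mulKmx.
Qed.

Lemma conj_mx_bracket (D Y : 'M[R]_n) :
  bracket (P *m D *m invmx P) (P *m Y *m invmx P) =
  P *m bracket D Y *m invmx P.
Proof.
rewrite /bracket mulmxBr mulmxBl.
by congr (_ - _); [exact: (conj_mxM Y D) | exact: (conj_mxM D Y)].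
Qed.

Lemma conj_mxX (Y : 'M[R]_n) k :
  (P *m Y *m invmx P) ^+ k = P *m Y ^+ k *m invmx P.
Proof.
elim: k => [|k IHk]; first by rewrite !expr0 mulmx1 mulmxV.
by rewrite !exprS IHk; exact: conj_mxM.
Qed.

Lemma conj_mx_eval g (Y : 'M[R]_n) :
  mx_eval g (P *m Y *m invmx P) = P *m mx_eval g Y *m invmx P.
Proof.
rewrite /mx_eval mulmx_sumr mulmx_suml; apply: eq_bigr => i _.
by rewrite conj_mxX -scalemxAr -scalemxAl.
Qed.

End MatrixEvaluation.

(** * Block-diagonal matrices *)

Section BlockDiagonal.

Variables (R : comUnitRingType) (r : nat) (m : 'I_r -> nat).
Implicit Types Xb : forall i : 'I_r, 'M[R]_(m i).

Lemma mxdiagM Xb Yb :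
  \mxdiag_i Xb i *m \mxdiag_i Yb i = \mxdiag_i (Xb i *m Yb i).
Proof.
rewrite {2}/mxdiag mul_mxdiag_mxblock; apply: eq_mxblock => i j.
by case: eqVneq => [<-|_]; rewrite ?conform_mx_id ?mulmx0.
Qed.

Lemma mxdiag_expr Xb k : (\mxdiag_i Xb i) ^+ k = \mxdiag_i (Xb i ^+ k).
Proof.
elim: k => [|k IHk].
  by rewrite expr0; symmetry; exact: mxdiagZ.
rewrite exprS IHk; transitivity (\mxdiag_i (Xb i *m Xb i ^+ k)).
  exact: mxdiagM.
by apply: eq_mxdiag => i; rewrite exprS.
Qed.

Lemma mxdiag_scale (c : R) Xb : c *: \mxdiag_i Xb i = \mxdiag_i (c *: Xb i).
Proof.
rewrite -mul_scalar_mx -mxdiagZ mxdiagM.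
by apply: eq_mxdiag => i; rewrite mul_scalar_mx.
Qed.

Lemma mx_eval_mxdiag (g : {poly R}) Xb :
  mx_eval g (\mxdiag_i Xb i) = \mxdiag_i mx_eval g (Xb i).
Proof.
rewrite /mx_eval mxdiag_sum; apply: eq_bigr => k _.
by rewrite mxdiag_expr mxdiag_scale.
Qed.

Variable lambda : 'I_r -> R.
Let D := \mxdiag_(i < r) ((lambda i)%:M : 'M[R]_(m i)).

Lemma submxblock_bracket (Y : 'M[R]_(\sum_i m i)) i j :
  submxblock (bracket D Y) i j = (lambda j - lambda i) *: submxblock Y i j.
Proof.
rewrite /bracket -[Y in LHS]submxblockK [_ * D]mul_mxblock_mxdiag.
rewrite [D * _]mul_mxdiag_mxblock -mxblockB mxblockK.
by rewrite mul_mx_scalar mul_scalar_mx scalerBl.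
Qed.

Lemma bracket_mxdiag Xb : bracket D (\mxdiag_i Xb i) = 0.
Proof.
rewrite /bracket [_ * D]mxdiagM [D * _]mxdiagM -mxdiagB -[RHS]mxdiag0.
by apply: eq_mxdiag => i; rewrite mul_mx_scalar mul_scalar_mx subrr.
Qed.

Hypothesis lambda_nzd :
  forall i j : 'I_r, i != j -> not_zero_divisor (lambda i - lambda j).

(** The block [(i, j)] of the iterate is [(lambda j - lambda i) ^+ k] times that
    of [Y], and off the diagonal this scalar is not a zero-divisor. *)
Lemma mxdiag_of_iter_bracket k (Y : 'M[R]_(\sum_i m i)) :
  iter k (bracket D) Y = 0 -> Y = \mxdiag_i submxblock Y i i.
Proof.
move=> Yk0; rewrite -[LHS]submxblockK; apply: eq_mxblock => i j.
case: eqVneq => [<-|ij]; first by rewrite conform_mx_id.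
have {Yk0} : submxblock (iter k (bracket D) Y) i j = 0.
  by rewrite Yk0 submxblock0.
elim: k => // k IHk; rewrite iterS submxblock_bracket => /matrixP Z0.
apply: IHk; apply/matrixP => u v; move: (Z0 u v); rewrite !mxE.
by apply: lambda_nzd; rewrite eq_sym.
Qed.

End BlockDiagonal.

(** * The nilpotent solutions *)

Theorem theorem2 (R : comUnitRingType) (r : nat) (m : 'I_r -> nat)
    (alpha : nat) (g : {poly R}) (lambda : 'I_r -> R)
    (A X : 'M[R]_(\sum_(i < r) m i)) :
  (2 <= \sum_(i < r) m i)%N ->
  (2 <= alpha)%N ->
  g.[0] != 0 ->
  similar_mx A (\mxdiag_(i < r) ((lambda i)%:M : 'M[R]_(m i))) ->
  (forall i j : 'I_r, i != j -> not_zero_divisor (lambda i - lambda j)) ->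
  nilpotent_mx X ->
  X *m A - A *m X = X ^+ alpha *m mx_eval g X ->
  (exists (P : 'M[R]_(\sum_(i < r) m i)) (Xb : forall i : 'I_r, 'M[R]_(m i)),
     [/\ P \in unitmx,
         A = P *m (\mxdiag_(i < r) ((lambda i)%:M : 'M[R]_(m i))) *m invmx P,
         X = P *m (\mxdiag_(i < r) Xb i) *m invmx P &
         forall i : 'I_r, Xb i ^+ alpha *m mx_eval g (Xb i) = 0])
  /\ (g.[0] \is a GRing.unit -> X ^+ alpha = 0).
Proof.
(* The matrix [P] diagonalizing [A] also puts [X] in block-diagonal form. *)
move=> _ alpha2 _ [P [Punit ->]] lambda_nzd Xnil.
set D := mxdiag _; move: Xnil.
have -> : X = P *m (invmx P *m X *m P) *m invmx P.
  by rewrite -mulmxA mulmxK // mulKVmx.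
move: (invmx P *m X *m P) => Y Xnil XA.
have [k Yk0] := iter_bracket_nilpotent_mx alpha2 Xnil XA.
have {}Yk0 : iter k (bracket D) Y = 0.
  apply: (conj_mx_inj Punit); rewrite -[RHS]Yk0.
  by elim: k {Yk0} => //= k <-; rewrite conj_mx_bracket.
have YE := mxdiag_of_iter_bracket lambda_nzd Yk0.
have XA0 : bracket (P *m D *m invmx P) (P *m Y *m invmx P) = 0.
  by rewrite conj_mx_bracket // YE bracket_mxdiag mulmx0 mul0mx.
(* A block-diagonal [X] commutes with [A], so its equation reads [f(X) = 0]. *)
have Xg0 := etrans (esym XA) XA0.
split; last by move=> g0; exact: expr_mx_eq0 Xg0.
exists P, (fun i => submxblock Y i i); split=> //; first by rewrite -YE.
apply/eq_mxdiagP; rewrite mxdiag0 -mxdiagM -mxdiag_expr -mx_eval_mxdiag -YE.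
by apply: (conj_mx_inj Punit); rewrite -conj_mxM // -conj_mxX // -conj_mx_eval.
Qed.
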